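(* Let $X$ be the path space of the Nicomachus graph. Let $X_{\mathrm{hor}}\subset X$ be the set of paths all of whose vertices are of the form $(n,0)$, and let $X_{\mathrm{ver}}\subset X$ be the set of paths all of whose vertices are of the form $(0,k)$ (the two boundary odometers). Then there is a unique invariant Borel probability measure $\mu_{\mathrm{hor}}$ with $\mu_{\mathrm{hor}}(X_{\mathrm{hor}})=1$, there is a unique invariant Borel probability measure $\mu_{\mathrm{ver}}$ with $\mu_{\mathrm{ver}}(X_{\mathrm{ver}})=1$, and the ergodic invariant Borel probability measures for the Nicomachus adic dynamical system are exactly $\mu_{\mathrm{hor}}$ and $\mu_{\mathrm{ver}}$.
   Context: **Nicomachus graph.** The directed graph with vertex set $\mathbb{Z}_{\ge 0}^2$ and root $R=(0,0)$, whose edges are exactly the following. For every $n\ge 0$ there are two edges from $(n,0)$ to $(n+1,0)$. For every $k\ge 0$ there are three edges from $(0,k)$ to $(0,k+1)$. For all $n,k\ge 0$ there is exactly one (diagonal) edge from $(n,k)$ to $(n+1,k+1)$. For all $n\ge 0$, $k\ge 1$ there is exactly one edge from $(n,k)$ to $(n+1,k)$. For all $n\ge 1$, $k\ge 0$ there is exactly one edge from $(n,k)$ to $(n,k+1)$. The edges entering each vertex are linearly ordered: the edges entering a vertex $(n,0)$ or $(0,k)$ are ordered arbitrarily, and the three edges entering $(n+1,k+1)$ ($n,k\ge0$) are ordered so that the edge from $(n+1,k)$ is first, the diagonal edge from $(n,k)$ is second, and the edge from $(n,k+1)$ is last. **Path space.** $X$ is the set of infinite directed paths (sequences of edges) starting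 at $R$, with the compact metrizable topology generated by cylinder sets; a cylinder set is the set of all paths in $X$ that begin with a given finite path segment starting at $R$, and it is said to end at the terminal vertex of that segment. **Tail relation and adic transformation.** Two paths $x,y\in X$ are tail equivalent if there is a vertex through which both pass and after which they follow the same edges. For distinct tail equivalent $x,y$, let $w$ be the first such vertex; put $x<y$ if the edge by which $x$ enters $w$ precedes the edge by which $y$ enters $w$. $X_{\max}$ (resp. $X_{\min}$) is the set of paths all of whose edges are last (resp. first) among the edges entering their terminal vertices. The adic transformation $T:X\setminus X_{\max}\to X\setminus X_{\min}$ sends $x$ to the smallest $y$ with $y>x$; its orbits are the tail equivalence classes. The pair $(X,T)$ is the Nicomachus adic dynamical system. **Invariance and ergodicity.** A Borel probability measure $\mu$ on $X$ is invariant if any two cylinder sets ending at the same vertex have the same $\mu$-measure (i.e. $\mu$ is invariant under the tail relation). An invariant $\mu$ is ergodic if every Borel set that is a union of tail equivalence classes has $\mu$-measure $0$ or $1$. *)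

(* Defs.v *)
From HB Require Import structures.
From mathcomp Require Import all_boot all_order all_algebra.
From mathcomp Require Import all_classical all_reals all_analysis.

Set Implicit Arguments.
Unset Strict Implicit.
Unset Printing Implicit Defensive.

Local Open Scope classical_set_scope.

(* The ergodic theory of the adic transformation T enters only through its     *)
(* orbit relation, which is tail equivalence: invariance and ergodicity of a   *)
(* measure refer to cylinder sets and to tail classes, never to the edge       *)
(* orders. Hence neither the edge orders nor T occur below.                    *)

Definition vertex : Type := (nat * nat)%type.

Definition root : vertex := (0, 0).

(* Number of edges from v to w. *)
Definition edge_mult (v w : vertex) : nat :=
  if w == (v.1.+1, v.2) then (if v.2 == 0 then 2 else 1)
  else if w == (v.1, v.2.+1) then (if v.1 == 0 then 3 else 1)
  else if w == (v.1.+1, v.2.+1) then 1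
  else 0.

(* The edges from v to w are the triples ((v, w), i) with i < edge_mult v w. *)
Record edge := Edge {
  edge_val :> vertex * vertex * nat;
  edge_valP : edge_val.2 < edge_mult edge_val.1.1 edge_val.1.2 }.

HB.instance Definition _ := [isSub for edge_val].
HB.instance Definition _ := [Countable of edge by <:].

Definition source (e : edge) : vertex := (edge_val e).1.1.
Definition target (e : edge) : vertex := (edge_val e).1.2.

Definition adjacent : rel edge := fun e f => source f == target e.

(* Infinite directed paths starting at the root. *)
Record npath := NPath {
  edge_at :> nat -> edge;
  edge_at0 : source (edge_at 0) = root;
  edge_atS : forall i, adjacent (edge_at i) (edge_at i.+1) }.

Definition vertex_at (x : npath) (i : nat) : vertex := source (x i).

Lemma hor_edge_subproof n : 0 < edge_mult (n, 0) (n.+1, 0).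
Proof. by rewrite /edge_mult eqxx. Qed.

Definition hor_edge n : edge :=
  @Edge ((n, 0), (n.+1, 0), 0) (hor_edge_subproof n).

Lemma hor_path_subproof i : adjacent (hor_edge i) (hor_edge i.+1).
Proof. exact: eqxx. Qed.

Definition hor_path : npath := @NPath hor_edge erefl hor_path_subproof.

HB.instance Definition _ := gen_eqMixin npath.
HB.instance Definition _ := gen_choiceMixin npath.
HB.instance Definition _ := isPointed.Build npath hor_path.

(* Finite directed paths starting at the root, possibly of length zero. *)
Definition segment (s : seq edge) : bool :=
  if s is e :: s' then (source e == root) && path adjacent e s' else true.

Definition segment_end (s : seq edge) : vertex := last root (map target s).

Definition cylinder (s : seq edge) : set npath :=
  [set x : npath | mkseq x (size s) = s].

Definition cylinders : set (set npath) := [set cylinder s | s in segment].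

HB.instance Definition _ :=
  @isSubBaseTopological.Build npath (set npath) cylinders id.

(* The path space with its Borel sigma-algebra. *)
Definition X : measurableType _ := g_sigma_algebraType (@open npath).

Definition tail_equiv (x y : npath) : Prop :=
  exists m n, vertex_at x m = vertex_at y n /\
    forall i, x (m + i) = y (n + i).

Definition tail_class (x : npath) : set npath := [set y | tail_equiv x y].

Definition X_hor : set X := [set x | forall i, (vertex_at x i).2 = 0].
Definition X_ver : set X := [set x | forall i, (vertex_at x i).1 = 0].

Definition invariant_measure (R : realType) (mu : probability X R) : Prop :=
  forall s t, segment s -> segment t -> segment_end s = segment_end t ->
    mu (cylinder s) = mu (cylinder t).

Definition ergodic_measure (R : realType) (mu : probability X R) : Prop :=
  forall A : set X, measurable A ->
    (exists C : set npath, A = \bigcup_(x in C) tail_class x) ->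
    mu A = 0%E \/ mu A = 1%E.

(* Equality of Borel measures. The library's measures are total functions on   *)
(* [set X], with unconstrained values outside the sigma-algebra, so Leibniz    *)
(* equality of [probability X R] would be too fine.                            *)
Definition same_measure (R : realType) (mu nu : probability X R) : Prop :=
  forall A : set X, measurable A -> mu A = nu A.

Definition unique_invariant_on (R : realType) (Y : set X)
    (mu : probability X R) : Prop :=
  [/\ invariant_measure mu, mu Y = 1%E
    & forall nu : probability X R,
        invariant_measure nu -> nu Y = 1%E -> same_measure nu mu].

(* Main.v *)
From HB Require Import structures.
From mathcomp Require Import all_boot all_order all_algebra.
From mathcomp Require Import all_classical all_reals all_analysis.
From mathcomp Require Import finmap zify ring lra.
Require Import Defs.

(** An invariant probability measure gives the same mass [w v] to all the cylinders
that end at a vertex [v], and [w] is harmonic: [w v] is the sum of the values of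
[w] at the ends of the edges leaving [v].  The point of the proof is that [w]
vanishes off the two axes.

The number of paths from the root to [(i, j)] is [2^i * 3^j], so [2^i * 3^j * w i j]
is the probability of passing through [(i, j)]; a path meets an antidiagonal at
most once, so these probabilities add up to at most 1 on each antidiagonal
([level_flow]).  From [(1, 1)] on, the graph has no multiple edges, and the number
of paths from [(1, 1)] to [(1 + i, 1 + j)] is the Delannoy number [D i j]; the same
identity bounds [w 1 1] by twice the supremum of [D i j / (2^i * 3^j)] over the far
antidiagonals.  Since [D i j] is the sum over [l] of ['C(i, l) * 'C(j, l) * 2^l],
that ratio is at most the largest of the ['C(i, l) / 2^i], which tends to 0 as [i]
grows, while for bounded [i] the ratio decays geometrically in [j]
([delannoy_decay]).  Hence [w 1 1 = 0], and harmonicity propagates this to all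
interior vertices ([harmonic_interior]).

So almost every path stays on an axis forever.  The two boundary odometers are
unions of tail classes, hence an ergodic measure gives full mass to one of them.
An invariant measure carried by an axis is determined by its total mass: on the
horizontal axis [w] is halved at each step, on the vertical axis it is divided by
3 ([hor_weight], [ver_weight]).  This gives uniqueness; it also gives ergodicity,
because the restriction of the measure to an invariant set [A] is again invariant
([restrict_invariant]) and so is [mu A] times [mu], which makes [A] independent of
itself ([rigid_ergodic]).  The measures themselves are the images of Lebesgue
measure on the unit interval under the binary and ternary digits
([ray_measure_ex]). *)

Set Implicit Arguments.
Unset Strict Implicit.
Unset Printing Implicit Defensive.

Import Order.TTheory GRing.Theory Num.Theory.

(** * Flows on the lattice *)

Section antidiagonal_sums.
Context {V : nmodType}.
Local Open Scope ring_scope.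

(** The sum of [f] over the antidiagonal [i + j = N]. *)
Definition antisum (f : nat -> nat -> V) (N : nat) : V :=
  \sum_(i < N.+1) f i (N - i)%N.

Lemma antisum0 f : antisum f 0 = f 0 0.
Proof. by rewrite /antisum big_ord_recl big_ord0 addr0. Qed.

Lemma antisumSl f N :
  antisum f N.+1 = f 0 N.+1 + antisum (fun i j => f i.+1 j) N.
Proof. by rewrite /antisum big_ord_recl. Qed.

Lemma antisumSr f N :
  antisum f N.+1 = antisum (fun i j => f i j.+1) N + f N.+1 0.
Proof.
rewrite /antisum big_ord_recr /= subnn; congr (_ + _).
by apply: eq_bigr => i _; rewrite subSn // -ltnS.
Qed.

Lemma antisumD f g N :
  antisum (fun i j => f i j + g i j) N = antisum f N + antisum g N.
Proof. exact: big_split. Qed.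

Lemma eq_antisum f g N :
  (forall i j, (i + j = N)%N -> f i j = g i j) -> antisum f N = antisum g N.
Proof.
by move=> fg; apply: eq_bigr => i _; apply: fg; rewrite subnKC // -ltnS.
Qed.

End antidiagonal_sums.

Section antidiagonal_order.
Context {R : realDomainType}.
Local Open Scope ring_scope.

Lemma le_antisum (f g : nat -> nat -> R) N :
  (forall i j, (i + j = N)%N -> f i j <= g i j) -> antisum f N <= antisum g N.
Proof. by move=> fg; apply: ler_sum => i _; apply: fg; rewrite subnKC // -ltnS. Qed.

Lemma antisum_ge0 (f : nat -> nat -> R) N :
  (forall i j, 0 <= f i j) -> 0 <= antisum f N.
Proof. by move=> f0; apply: sumr_ge0. Qed.

Lemma antisum_shift (f : nat -> nat -> R) N : (forall i j, 0 <= f i j) ->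
  antisum (fun i j => f i.+1 j.+1) N <= antisum f N.+2.
Proof.
move=> f0; rewrite antisumSl antisumSr.
by rewrite addrCA lerDl addr_ge0.
Qed.

Lemma antisumZ c (f : nat -> nat -> R) N :
  antisum (fun i j => c * f i j) N = c * antisum f N.
Proof. by rewrite /antisum mulr_sumr. Qed.

End antidiagonal_order.

Section flow.
Context {R : realDomainType}.
Local Open Scope ring_scope.

(** The number of edges along a side of the quadrant: [m] on the axis itself
and [1] off the axis, [k] being the distance to the axis. *)
Definition axis_mult (m k : nat) : R := if k is 0 then m%:R else 1.

(** [w] takes at every vertex the sum of its values at the ends of the outgoing
edges, for the graph on the quadrant with unit diagonal steps, [p]-fold edges
along the horizontal axis and [q]-fold edges along the vertical axis. *)
Definition harmonic (p q : nat) (w : nat -> nat -> R) : Prop :=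
  forall i j, w i j =
    axis_mult p j * w i.+1 j + axis_mult q i * w i j.+1 + w i.+1 j.+1.

(** [a] counts the paths of that graph that start at the corner. *)
Definition path_count (p q : nat) (a : nat -> nat -> R) : Prop :=
  [/\ a 0 0 = 1, forall i, a i.+1 0 = p%:R * a i 0,
      forall j, a 0 j.+1 = q%:R * a 0 j
    & forall i j, a i.+1 j.+1 = a i j.+1 + a i.+1 j + a i j].

(** Every path from the corner crosses the antidiagonal [i + j = N + 1] exactly
once, either at a vertex or along a diagonal edge that jumps over it. *)
Lemma level_flow p q a w : path_count p q a -> harmonic p q w -> forall N,
  antisum (fun i j => a i j * w i j) N.+1 +
  antisum (fun i j => a i j * w i.+1 j.+1) N = w 0 0.
Proof.
move=> [a00 ai0 a0j aij] hw.
(* contributions of the horizontal, vertical and diagonal edges entering [(i, j)] *)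
pose F i j := if i is i'.+1 then a i' j * axis_mult p j * w i j else 0.
pose G i j := if j is j'.+1 then a i j' * axis_mult q i * w i j else 0.
pose H i j := if i is i'.+1 then if j is j'.+1 then a i' j' * w i j else 0 else 0.
have AFGH N : antisum (fun i j => a i j * w i j) N.+1 =
    antisum F N.+1 + antisum G N.+1 + antisum H N.+1.
  rewrite -!antisumD; apply: eq_antisum => -[|i] [|j] //= _.
  - by rewrite a0j /=; ring.
  - by rewrite ai0 /=; ring.
  - by rewrite aij /=; ring.
have split_w N : antisum (fun i j => a i j * w i j) N =
    antisum F N.+1 + antisum G N.+1 + antisum (fun i j => a i j * w i.+1 j.+1) N.
  rewrite antisumSl add0r antisumSr addr0 -!antisumD.
  by apply: eq_antisum => i j _; rewrite [w i j]hw /=; ring.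
elim=> [|N IH].
  have := split_w 0; rewrite [X in X = _]antisum0 a00 mul1r => ->.
  rewrite AFGH; congr (_ + _).
  by rewrite [antisum H 1]antisumSl antisum0 !addr0.
rewrite AFGH -[RHS]IH [in RHS]split_w.
rewrite -!addrA; do 2 congr (_ + _); rewrite addrC; congr (_ + _).
by rewrite antisumSl add0r antisumSr addr0.
Qed.

End flow.

(** * Delannoy numbers *)

(** The number of lattice paths from [(0, 0)] to [(i, j)] with steps [(1, 0)],
[(0, 1)] and [(1, 1)], in closed form. *)
Definition delannoy (i j : nat) : nat :=
  \sum_(l < i.+1) 'C(i, l) * 'C(j, l) * 2 ^ l.

Lemma delannoyE M i j : i < M ->
  delannoy i j = \sum_(l < M) 'C(i, l) * 'C(j, l) * 2 ^ l.
Proof.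
move=> iM; rewrite /delannoy (big_ord_widen _ (fun l => 'C(i, l) * 'C(j, l) * 2 ^ l) iM).
rewrite big_mkcond /=; apply: eq_bigr => l _.
by case: ltnP => // il; rewrite bin_small.
Qed.

Lemma delannoyi0 i : delannoy i 0 = 1.
Proof.
rewrite /delannoy big_ord_recl big1 ?bin0 // => l _.
by rewrite muln0.
Qed.

Lemma delannoy0j j : delannoy 0 j = 1.
Proof. by rewrite /delannoy big_ord_recl big_ord0 !bin0. Qed.

(** Pascal's rule in both binomial factors. *)
Lemma delannoyS i j :
  delannoy i.+1 j.+1 = delannoy i j.+1 + delannoy i.+1 j + delannoy i j.
Proof.
pose b (n l : nat) := 'C(n, l).
pose s M f := \sum_(l < M) f l * 2 ^ l.
have e1 n m : n <= i.+1 ->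
    delannoy n m = 1 + 2 * s i.+2 (fun l => b n l.+1 * b m l.+1).
  move=> ni; rewrite (delannoyE m (leqW ni : n < i.+3)) big_ord_recl !bin0.
  congr (_ + _); rewrite /s big_distrr /=; apply: eq_bigr => l _.
  by rewrite expnS mulnCA.
have e2 : delannoy i j = s i.+2 (fun l => b i l * b j l) by apply: delannoyE.
have sD f g : s i.+2 f + s i.+2 g = s i.+2 (fun l => f l + g l).
  by rewrite -big_split; apply: eq_bigr => l _; rewrite mulnDl.
pose t f := s i.+2 f.
have k1 : t (fun l => b i.+1 l.+1 * b j.+1 l.+1) =
  t (fun l => b i l.+1 * b j l.+1) + t (fun l => b i l.+1 * b j l) +
  t (fun l => b i l * b j l.+1) + t (fun l => b i l * b j l).
  rewrite /t !sD; apply: eq_bigr => l _; congr (_ * _).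
  by rewrite /b !binS; ring.
have k2 : t (fun l => b i l.+1 * b j.+1 l.+1) =
  t (fun l => b i l.+1 * b j l.+1) + t (fun l => b i l.+1 * b j l).
  rewrite /t !sD; apply: eq_bigr => l _; congr (_ * _).
  by rewrite /b !binS; ring.
have k3 : t (fun l => b i.+1 l.+1 * b j l.+1) =
  t (fun l => b i l.+1 * b j l.+1) + t (fun l => b i l * b j l.+1).
  rewrite /t !sD; apply: eq_bigr => l _; congr (_ * _).
  by rewrite /b !binS; ring.
have e3 := e1 i j (leqnSn i).
rewrite (e1 i.+1) // (e1 i) // (e1 i.+1 j) //.
rewrite -/(t _) -/(t (fun l => b i l.+1 * b j.+1 l.+1)).
rewrite -/(t (fun l => b i.+1 l.+1 * b j l.+1)).
rewrite k1 k2 k3; move: e3; rewrite -/(t _) e2 -/(t _).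
lia.
Qed.

Lemma central_bin_bound m : 'C(m.*2, m) ^ 2 * m.*2.+1 <= 16 ^ m.
Proof.
elim: m => // m IH.
have e : m.+1 * 'C(m.+1.*2, m.+1) = m.*2.+1.*2 * 'C(m.*2, m).
  have h1 : m.+1 * 'C(m.*2.+1, m.+1) = m.*2.+1 * 'C(m.*2, m).
    by rewrite mul_bin_diag.
  have h2 : 'C(m.*2.+2, m.+1) = 'C(m.*2.+1, m.+1).*2.
    rewrite binS -[RHS]addnn; congr (_ + _).
    by rewrite -bin_sub; [congr 'C(_, _); lia | lia].
  by rewrite doubleS h2; lia.
have h : m.+1 ^ 2 * ('C(m.+1.*2, m.+1) ^ 2 * m.+1.*2.+1) <= m.+1 ^ 2 * 16 ^ m.+1.
  rewrite mulnA -expnMn e (expnS 16).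
  apply: (@leq_trans (m.*2.+1.*2 * m.+1.*2.+1 * 2 * ('C(m.*2, m) ^ 2 * m.*2.+1))).
    by apply: eq_leq; rewrite -!muln2; ring.
  apply: (leq_trans (leq_mul (leqnn _) IH)).
  by rewrite mulnA leq_mul2r; apply/orP; right; nia.
by rewrite leq_pmul2l in h; rewrite ?expn_gt0.
Qed.

Lemma bin_bound m l : 'C(m, l) ^ 4 * m.*2.+1 <= 16 ^ m.
Proof.
apply: leq_trans (central_bin_bound m); rewrite leq_mul2r; apply/orP; right.
rewrite (expnM _ 2 2) leq_sqr.
case: (leqP l m) => [lm|ml]; last by rewrite bin_small.
(* the Vandermonde sum for the central coefficient contains this square *)
rewrite -addnn -binomial.Vandermonde (bigD1 (Ordinal (ltnSE lm : l < m.+1))) //=.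
by rewrite bin_sub // mulnn leq_addr.
Qed.

Lemma sum_bin_pow2 j M : \sum_(l < M) 'C(j, l) * 2 ^ l <= 3 ^ j.
Proof.
have -> : 3 ^ j = \sum_(l < j.+1) 'C(j, l) * 2 ^ l.
  by rewrite -[3]/(1 + 2) expnDn; apply: eq_bigr => l _; rewrite exp1n mul1n.
case: (leqP M j.+1) => [Mj|jM].
  rewrite (big_ord_widen _ (fun l => 'C(j, l) * 2 ^ l) Mj) big_mkcond /=.
  by apply: leq_sum => l _; case: ifP.
rewrite (big_ord_widen _ (fun l => 'C(j, l) * 2 ^ l) (ltnW jM)).
rewrite [leqRHS]big_mkcond /=.
by apply: leq_sum => l _; case: ltnP => // jl; rewrite bin_small.
Qed.

(** Once the factor ['C(i, l)] is bounded, the binomial theorem for [(1 + 2)^j] sums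
the rest. *)
Lemma delannoy_le_bin i j c : (forall l, 'C(i, l) <= c) ->
  delannoy i j <= c * 3 ^ j.
Proof.
move=> bc; apply: leq_trans (leq_mul (leqnn c) (sum_bin_pow2 j i.+1)).
by rewrite big_distrr /=; apply: leq_sum => l _; rewrite -mulnA leq_mul.
Qed.

Lemma delannoy_le_geometric i j : delannoy i j * 2 ^ j <= 6 ^ i * 3 ^ j.
Proof.
elim: i j => [|i IHi] j.
  by rewrite delannoy0j expn0 !mul1n; case: j => // j; rewrite leq_exp2r.
elim: j => [|j IHj]; first by rewrite delannoyi0 !muln1 expn_gt0.
have := IHi j.+1; have := IHi j; move: IHj.
rewrite delannoyS !expnS; nia.
Qed.

Section delannoy_decay.
Context {R : realType}.
Local Open Scope ring_scope.

(** The random walk with steps [(1, 0)], [(0, 1)], [(1, 1)] taken with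
probabilities 1/2, 1/3, 1/6 visits [(i, j)] with a probability that tends to [0]
as [i + j] grows, uniformly in the direction. *)
Lemma delannoy_decay (e : R) : 0 < e -> exists N, forall i j, (N <= i + j)%N ->
  (delannoy i j)%:R <= e * (2 ^ i * 3 ^ j)%:R.
Proof.
move=> e0.
(* for [M <= i] all the ['C(i, l) / 2^i] are at most [e], by [bin_bound] *)
pose M := (Num.truncn (e ^- 4)).+1.
have eM : 1 <= e ^+ 4 * M%:R.
  rewrite mulrC -ler_pdivrMr ?exprn_gt0 // mul1r.
  by apply/ltW; rewrite /M truncnS_gt.
(* for [i < M] and [K <= j] the geometric bound [3^i / 2^j] is at most [e] *)
pose K := (Num.truncn (3 ^+ M / e)).+1.
have eK : 3 ^+ M <= e * 2 ^+ K.
  rewrite mulrC -ler_pdivrMr //.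
  apply: le_trans (ltW (truncnS_gt _)) _.
  by rewrite -[X in _ <= X]natrX ler_nat ltnW // ltn_expl.
exists (M + K)%N => i j MKij.
case: (leqP M i) => [Mi|iM].
- pose c := \max_(l < i.+1) 'C(i, l).
  have ci l : ('C(i, l) <= c)%N.
    case: (ltnP l i.+1) => il; last by rewrite bin_small.
    exact: (@leq_bigmax _ (fun l : 'I_i.+1 => 'C(i, l)) (Ordinal il)).
  have c16 : (c ^ 4 * i.*2.+1 <= 16 ^ i)%N.
    have i1 : (0 < #|'I_i.+1|)%N by rewrite card_ord.
    rewrite /c; have [l ->] := @bigop.eq_bigmax _ (fun l : 'I_i.+1 => 'C(i, l)) i1.
    exact: bin_bound.
  have ce : c%:R <= e * 2 ^+ i :> R.
    rewrite -(@ler_pXn2r _ 4) ?nnegrE ?mulr_ge0 ?(ltW e0) ?exprn_ge0 //.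
    apply: (@le_trans _ _ (e ^+ 4 * M%:R * c%:R ^+ 4)).
      by rewrite ler_peMl ?exprn_ge0.
    rewrite exprMn -exprM mulnC exprM -[2 ^+ 4]natrX -[X in _ <= _ * X]natrX.
    rewrite -mulrA ler_pM2l ?exprn_gt0 // -natrX -natrM ler_nat mulnC.
    by apply: leq_trans c16; rewrite leq_mul2l; apply/orP; right; lia.
  apply: (@le_trans _ _ (c * 3 ^ j)%:R); first by rewrite ler_nat delannoy_le_bin.
  by rewrite !natrM mulrA ler_wpM2r // [(2 ^ i)%:R]natrX.
- have Kj : (K <= j)%N by lia.
  have h : (delannoy i j * 2 ^ j)%:R <= (6 ^ i * 3 ^ j)%:R :> R.
    by rewrite ler_nat delannoy_le_geometric.
  rewrite -(@ler_pM2r _ (2 ^ j)%:R) ?ltr0n ?expn_gt0 // -natrM.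
  apply: le_trans h _.
  rewrite -[6%N]/(3 * 2)%N expnMn !natrM.
  have h3 : (3 ^ i)%:R <= e * (2 ^ j)%:R :> R.
    apply: (@le_trans _ _ (e * 2 ^+ K)).
      by apply: le_trans eK; rewrite -natrX ler_nat leq_exp2l // ltnW.
    by rewrite ler_pM2l // -natrX ler_nat leq_exp2l.
  have := ler_wpM2r (mulr_ge0 (ler0n R (2 ^ i)) (ler0n R (3 ^ j))) h3.
  by nra.
Qed.

End delannoy_decay.

Section no_interior_mass.
Context {R : realType}.
Local Open Scope ring_scope.
Variables (w : nat -> nat -> R).
Hypotheses (hw : harmonic 2 3 w) (w0 : forall i j, 0 <= w i j).

(* the mass of the paths through [(i, j)], the total mass being [w 0 0] *)
Let phi i j : R := (2 ^ i * 3 ^ j)%:R * w i j.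

Let phi_ge0 i j : 0 <= phi i j.
Proof. by rewrite /phi mulr_ge0. Qed.

Lemma path_count_pow : path_count 2 3 (fun i j => (2 ^ i * 3 ^ j)%:R : R).
Proof.
split=> [|i|j|i j]; rewrite -?natrM -?natrD ?expnS //; congr _%:R; ring.
Qed.

Lemma path_count_delannoy : path_count 1 1 (fun i j => (delannoy i j)%:R : R).
Proof.
by split=> [|i|j|i j]; rewrite ?delannoyS ?delannoyi0 ?delannoy0j ?natrD // mul1r.
Qed.

Let antisum_phi N : antisum phi N.+1 <= w 0 0.
Proof.
rewrite -(level_flow path_count_pow hw N) lerDl; apply: antisum_ge0 => i j.
by rewrite mulr_ge0.
Qed.

Let phi_shift i j : (2 ^ i * 3 ^ j)%:R * w i.+1 j.+1 <= phi i.+1 j.+1.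
Proof.
by rewrite ler_wpM2r // ler_nat leq_mul // leq_exp2l.
Qed.

Lemma harmonic_corner : w 1 1 = 0.
Proof.
(* seen from [(1, 1)], the graph has only simple edges *)
pose w' i j := w i.+1 j.+1.
have hw' : harmonic 1 1 w'.
  by move=> [|i] [|j]; rewrite /w' hw.
suff w11 : w 1 1 <= 0 by apply: le_anti; rewrite w11 w0.
apply/ler_addgt0Pr => e e0; rewrite add0r.
have w00 : 0 < w 0 0 + 1 by rewrite ltr_wpDl.
(* each of the two sums of [level_flow] will be at most [d * w 0 0] *)
pose d := e / (w 0 0 + 1) / 2.
have d0 : 0 < d by rewrite !divr_gt0.
have [N HN] := delannoy_decay d0.
rewrite -[w 1 1]/(w' 0 0) -(level_flow path_count_delannoy hw' N).
have sum_le f n : (N <= n)%N -> (forall i j, 0 <= f i j) ->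
    (forall i j, (2 ^ i * 3 ^ j)%:R * f i j <= phi i.+1 j.+1) ->
    antisum (fun i j => (delannoy i j)%:R * f i j) n <= d * w 0 0.
  move=> Nn f0 fphi; apply: (@le_trans _ _ (d * antisum (fun i j => phi i.+1 j.+1) n)).
    rewrite -antisumZ; apply: le_antisum => i j ijn.
    apply: (@le_trans _ _ (d * ((2 ^ i * 3 ^ j)%:R * f i j))).
      by rewrite mulrA ler_wpM2r // HN // ijn.
    by rewrite ler_pM2l.
  by rewrite ler_pM2l //; apply: le_trans (antisum_shift _ phi_ge0) (antisum_phi _).
have s1 : antisum (fun i j => (delannoy i j)%:R * w' i j) N.+1 <= d * w 0 0.
  by apply: sum_le; [exact: leqnSn | move=> i j; exact: w0 | exact: phi_shift].
have s2 : antisum (fun i j => (delannoy i j)%:R * w' i.+1 j.+1) N <= d * w 0 0.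
  apply: (@le_trans _ _ (d * antisum (fun i j => phi i.+2 j.+2) N)).
    rewrite -antisumZ; apply: le_antisum => i j ijn.
    apply: (@le_trans _ _ (d * ((2 ^ i * 3 ^ j)%:R * w' i.+1 j.+1))).
      by rewrite mulrA ler_wpM2r /w' // HN // ijn.
    rewrite ler_pM2l // ler_wpM2r /w' // ler_nat leq_mul // leq_exp2l //; lia.
  rewrite ler_pM2l //.
  apply: le_trans (@antisum_shift _ (fun i j => phi i.+1 j.+1) _ _) _ => //.
  exact: le_trans (antisum_shift _ phi_ge0) (antisum_phi _).
apply: le_trans (lerD s1 s2) _.
apply: (@le_trans _ _ (d * (w 0 0 + 1) * 2)); first by nra.
by rewrite le_eqVlt; apply/orP; left; apply/eqP; rewrite /d; field; exact: lt0r_neq0.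
Qed.

Lemma harmonic_interior i j : w i.+1 j.+1 = 0.
Proof.
have step i' j' : w i'.+1 j'.+1 = 0 -> w i'.+2 j'.+1 = 0 /\ w i'.+1 j'.+2 = 0.
  rewrite hw /= !mul1r => h.
  have := w0 i'.+2 j'.+1; have := w0 i'.+1 j'.+2; have := w0 i'.+2 j'.+2.
  by split; lra.
elim: i j => [|i IH] j; last by have [] := step _ _ (IH j).
by elim: j => [|j IHj]; [exact: harmonic_corner | have [] := step _ _ IHj].
Qed.

End no_interior_mass.

Local Open Scope classical_set_scope.

(** * Paths and cylinders *)

(** The three directions of an edge from [v] to [w]. *)
Variant edge_spec (v w : vertex) : Prop :=
  | EdgeRight of w = (v.1.+1, v.2)
  | EdgeUp of w = (v.1, v.2.+1)
  | EdgeDiag of w = (v.1.+1, v.2.+1).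

Lemma edgeP (e : edge) : edge_spec (source e) (target e).
Proof.
have := edge_valP e; rewrite -/(source e) -/(target e) /edge_mult.
case: eqP => [h _|_]; first exact: EdgeRight.
case: eqP => [h _|_]; first exact: EdgeUp.
by case: eqP => [h _|_ //]; exact: EdgeDiag.
Qed.

Lemma edge_ext (e f : edge) :
  source e = source f -> target e = target f ->
  (edge_val e).2 = (edge_val f).2 -> e = f.
Proof.
move=> ef1 ef2 ef3; apply: val_inj => /=.
move: ef1 ef2 ef3; rewrite /source /target.
by case: (edge_val e) (edge_val f) => -[a b] c [[a' b'] c'] /= -> -> ->.
Qed.

Lemma vertex_atS (x : npath) i : vertex_at x i.+1 = target (x i).
Proof. exact/eqP/(edge_atS x i). Qed.

Lemma vertex_at0 (x : npath) : vertex_at x 0 = root.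
Proof. exact: edge_at0. Qed.

Lemma vertex_at_mono (x : npath) i j : i <= j ->
  (vertex_at x i).1 <= (vertex_at x j).1 /\
  (vertex_at x i).2 <= (vertex_at x j).2.
Proof.
elim: j => [|j IH]; first by case: i.
rewrite leq_eqVlt => /predU1P[-> //|/IH [h1 h2]].
by rewrite vertex_atS; have [->|->|->] := edgeP (x j); rewrite -/(vertex_at x j) /=; lia.
Qed.

Lemma segment_rcons s e :
  segment (rcons s e) = segment s && (source e == segment_end s).
Proof.
by case: s => [|f s] /=; rewrite /segment_end /= ?andbT // rcons_path last_map andbA.
Qed.

Lemma segment_end_rcons s e : segment_end (rcons s e) = target e.
Proof. by rewrite /segment_end map_rcons last_rcons. Qed.

Lemma mkseqS (f : nat -> edge) n : mkseq f n.+1 = rcons (mkseq f n) (f n).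
Proof. by rewrite /mkseq -addn1 iotaD map_cat cats1. Qed.

Lemma segment_end_mkseq (x : npath) n : segment_end (mkseq x n) = vertex_at x n.
Proof.
case: n => [|n]; first by rewrite vertex_at0.
by rewrite mkseqS segment_end_rcons vertex_atS.
Qed.

Lemma segment_mkseq (x : npath) n : segment (mkseq x n).
Proof.
elim: n => // n IH.
by rewrite mkseqS segment_rcons IH segment_end_mkseq eqxx.
Qed.

Lemma cylinder_mkseq (x : npath) n : cylinder (mkseq x n) x.
Proof. by rewrite /cylinder /= size_mkseq. Qed.

Lemma cylinder_segment x s : cylinder s x -> segment s.
Proof. by move=> <-; exact: segment_mkseq. Qed.

Lemma cylinder_end x s : cylinder s x -> vertex_at x (size s) = segment_end s.
Proof. by move=> {2}<-; rewrite segment_end_mkseq. Qed.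

Lemma cylinder_nil : cylinder [::] = setT.
Proof. by apply/seteqP; split. Qed.

Lemma cylinder_rcons s e :
  cylinder (rcons s e) = cylinder s `&` [set x : npath | x (size s) = e].
Proof.
apply/seteqP; split=> x /=; rewrite /cylinder /= size_rcons mkseqS.
  by move=> /rcons_inj[-> ->].
by move=> [-> ->].
Qed.

Lemma take_mkseq (x : npath) m n : m <= n -> take m (mkseq x n) = mkseq x m.
Proof. by move=> mn; rewrite /mkseq -map_take take_iota (minn_idPl mn). Qed.

Lemma cylinder_sub s t : prefix s t -> cylinder t `<=` cylinder s.
Proof.
move=> /prefixP[r ->] x; rewrite /cylinder /= => h.
have := congr1 (take (size s)) h.
by rewrite take_mkseq ?size_cat ?leq_addr // take_size_cat.
Qed.

Lemma cylinder_disjoint s t x : size s <= size t ->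
  cylinder s x -> cylinder t x -> prefix s t.
Proof.
move=> st; rewrite /cylinder /= => sx tx; rewrite prefixE.
by rewrite -[in take _ _]tx take_mkseq // sx.
Qed.

Lemma cylinderI s t :
  cylinder s `&` cylinder t = set0 \/
  exists u, (prefix s u /\ prefix t u) /\ cylinder s `&` cylinder t = cylinder u.
Proof.
wlog st : s t / size s <= size t.
  move=> W; case: (leqP (size s) (size t)) => [|/ltnW] /W //.
  by rewrite setIC => -[->|[u [[us ut] ->]]]; [left|right; exists u].
have [pst|npst] := boolP (prefix s t).
  right; exists t; split; first by rewrite pst prefix_refl.
  exact/setIidPr/cylinder_sub.
left; apply/seteqP; split=> // x [/= sx tx].
by have := cylinder_disjoint st sx tx; rewrite (negbTE npst).
Qed.

(** * The Borel sigma-algebra of the path space *)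

Lemma open_cylinder s : open (cylinder s).
Proof.
have [sg|nsg] := boolP (segment s); last first.
  suff -> : cylinder s = set0 by exact: open0.
  by apply/seteqP; split=> // x /cylinder_segment; rewrite (negbTE nsg).
exists [set cylinder s]; last by rewrite bigcup_set1.
move=> _ /= ->; exists [fset (cylinder s : set npath)]%fset => /=.
  by move=> A; rewrite inE => /eqP ->; apply/mem_set; exists s.
apply/seteqP; split=> [x h|x sx A /=]; first by apply: h; rewrite /= inE.
by rewrite inE => /eqP ->.
Qed.

(** Around each of its points, an open set contains a cylinder. *)
Lemma open_sub_cylinder (U : set npath) x : open U -> U x ->
  exists n, cylinder (mkseq x n) `<=` U.
Proof.
move=> [D sD <-] [V DV Vx]; have [F FD VF] := sD _ DV.
have H A : exists n, A \in F -> cylinder (mkseq x n) `<=` A.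
  have [AF|nAF] := pselect (A \in F); last by exists 0.
  have /set_mem := FD A AF => -[s ss sA]; exists (size s) => _.
  have : A x by move: Vx; rewrite -VF; apply.
  by rewrite -sA /cylinder /= => h; rewrite h.
have [f hf] := choice H.
exists (\max_(A <- F) f A) => y yx; exists V; first exact: DV.
suff : V y by []; rewrite -VF => A /= AF.
apply: (hf A AF); apply: (@cylinder_sub _ (mkseq x (\max_(A <- F) f A))) => //.
by rewrite prefixE size_mkseq take_mkseq // leq_bigmax_seq.
Qed.

Lemma measurable_cylinder s : measurable (cylinder s : set X).
Proof. by apply: sub_sigma_algebra; exact: open_cylinder. Qed.

Lemma cylinder_coverE (U : set npath) :
  (forall x, U x -> exists n, cylinder (mkseq x n) `<=` U) ->
  U = \bigcup_s (if `[< cylinder s `<=` U >] then cylinder s else set0).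
Proof.
move=> hU; apply/seteqP; split=> [x Ux|x [s _]]; last first.
  by case: asboolP => // sU; exact: sU.
have [n hn] := hU x Ux; exists (mkseq x n) => //.
by rewrite asboolT //; exact: cylinder_mkseq.
Qed.

(** A set of paths is measurable when each of its members has an initial segment
that forces membership. *)
Lemma measurable_cylinder_union (U : set X) :
  (forall x, U x -> exists n, cylinder (mkseq x n) `<=` U) -> measurable U.
Proof.
move/cylinder_coverE->; apply: countable_bigcupT_measurable => [|s].
  exact: countableP.
by case: ifP => _ //; exact: measurable_cylinder.
Qed.

(** The cylinders, completed with the empty set to a pi-system. *)
Definition cylinder_system : set (set X) :=
  [set A | A = set0 \/ exists s, A = cylinder s].

Lemma measurable_cylinder_system :
  @measurable _ X = <<s cylinder_system >>.
Proof.
apply/seteqP; split; last first.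
  apply: smallest_sub; first exact: sigma_algebra_measurable.
  by move=> _ [->|[s ->]]; [exact: measurable0 | exact: measurable_cylinder].
apply: smallest_sub; first exact: smallest_sigma_algebra.
move=> U oU.
rewrite (@cylinder_coverE U (fun x => @open_sub_cylinder U x oU)).
apply: (@countable_bigcupT_measurable _ (g_sigma_algebraType cylinder_system)) => [|s].
  exact: countableP.
case: ifP => _; last exact: measurable0.
by apply: sub_sigma_algebra; right; exists s.
Qed.

Lemma setI_closed_cylinder_system : setI_closed cylinder_system.
Proof.
move=> A B [->|[s ->]] => [_|[->|[t ->]]].
- by rewrite set0I; left.
- by rewrite setI0; left.
- by case: (cylinderI s t) => [->|[u [_ ->]]]; [left | right; exists u].
Qed.

Section measures.
Context {R : realType}.
Local Open Scope ring_scope.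
Local Open Scope ereal_scope.

(** Finite Borel measures that agree on the cylinders are equal. *)
Lemma eq_cylinder_measure (m1 m2 : {measure set X -> \bar R}) :
  m1 setT < +oo -> (forall s, segment s -> m1 (cylinder s) = m2 (cylinder s)) ->
  forall A, measurable A -> m1 A = m2 A.
Proof.
move=> m1oo m12 A mA.
apply: (measure_unique cylinder_system (fun=> setT)) => //.
- exact: measurable_cylinder_system.
- exact: setI_closed_cylinder_system.
- by move=> _; right; exists [::]; rewrite cylinder_nil.
- by rewrite bigcup_const.
- move=> _ [->|[s ->]]; first by rewrite !measure0.
  have [/m12 //|ns] := boolP (segment s).
  suff -> : cylinder s = set0 by rewrite !measure0.
  by apply/seteqP; split=> // x /cylinder_segment; rewrite (negbTE ns).
Qed.

Lemma measurable_fun_cylinder d (T : measurableType d) (f : T -> X) :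
  (forall s, segment s -> measurable (f @^-1` cylinder s)) ->
  measurable_fun setT f.
Proof.
move=> mf; apply: (@measurability _ _ _ _ _ _ cylinder_system).
  exact: measurable_cylinder_system.
move=> _ [_ [->|[s ->]] <-]; rewrite setTI; first by rewrite preimage_set0.
have [/mf //|ns] := boolP (segment s).
suff -> : f @^-1` cylinder s = set0 by [].
by apply/seteqP; split=> // x /cylinder_segment; rewrite (negbTE ns).
Qed.

Lemma measurable_visit (P : set vertex) :
  measurable ([set x | exists n, P (vertex_at x n)] : set X).
Proof.
apply: measurable_cylinder_union => x [n Pn]; exists n => y.
move/cylinder_end; rewrite size_mkseq segment_end_mkseq => yn.
by exists n; rewrite yn.
Qed.

(** The event of ever visiting a set [P] of vertices is null as soon as the
cylinders that end in [P] are. *)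
Lemma visit_null (mu : {measure set X -> \bar R}) (P : set vertex) :
  (forall s, segment s -> P (segment_end s) -> mu (cylinder s) = 0) ->
  mu [set x | exists n, P (vertex_at x n)] = 0.
Proof.
move=> mu0; apply/negligibleP; first exact: measurable_visit.
pose F (k : nat) : set X := if choice.unpickle k : option (seq edge) is Some s then
  if `[< segment s /\ P (segment_end s) >] then cylinder s else set0 else set0.
apply: (@negligibleS _ _ _ _ (\bigcup_k F k)); last first.
  apply: negligible_bigcup => k; rewrite /F.
  case: (choice.unpickle k) => [s|]; last exact: negligible_set0.
  case: asboolP => [[ss Ps]|_]; last exact: negligible_set0.
  apply/negligibleP; first exact: measurable_cylinder.
  exact: mu0.
move=> x [n Pn]; exists (choice.pickle (mkseq x n)) => //; rewrite /F choice.pickleK.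
rewrite asboolT; first exact: cylinder_mkseq.
by rewrite segment_end_mkseq; split => //; exact: segment_mkseq.
Qed.

End measures.

(** * Outgoing edges *)

(** The vertices that can be reached from [v] along one edge. *)
Definition out_targets (v : vertex) : seq vertex :=
  [:: (v.1.+1, v.2); (v.1, v.2.+1); (v.1.+1, v.2.+1)].

Definition out_triples (v : vertex) : seq (vertex * vertex * nat) :=
  [seq ((v, w), i) | w <- out_targets v, i <- iota 0 (edge_mult v w)].

(** The edges that leave [v]. *)
Definition out_edges (v : vertex) : seq edge := pmap insub (out_triples v).

Lemma uniq_out_edges v : uniq (out_edges v).
Proof.
apply: pmap_sub_uniq; apply: allpairs_uniq_dep.
- by rewrite /= !inE !xpair_eqE; case: v => a b /=; lia.
- by move=> w _; exact: iota_uniq.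
- by move=> [w1 i1] [w2 i2] _ _ /= [-> ->].
Qed.

Lemma mem_out_edges e v : (e \in out_edges v) = (source e == v).
Proof.
rewrite mem_pmap_sub /=; apply/allpairsPdep/eqP => [[w [i [_ _ e_]]]|ev].
  by rewrite /source e_.
exists (target e), (edge_val e).2; split.
- rewrite -ev !inE; have [->|->|->] := edgeP e; rewrite eqxx ?orbT //.
- by rewrite mem_iota /= add0n -ev; exact: (edge_valP e).
- by rewrite -ev /source /target; case: (edge_val e) => -[].
Qed.

Lemma sum_out_edges (V : nmodType) (F : vertex -> V) v :
  (\sum_(e <- out_edges v) F (target e) =
   \sum_(w <- out_targets v) F w *+ edge_mult v w)%R.
Proof.
rewrite -(big_map edge_val xpredT (fun p => F p.1.2)) /out_edges.
rewrite (pmap_filter (insubK _)) (all_filterP _).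
  rewrite big_allpairs_dep; apply: eq_bigr => w _ /=.
  by rewrite big_const_seq count_predT size_iota iter_addr_0.
by apply/allP => _ /allpairsPdep[w [i [_ + ->]]]; rewrite mem_iota /= isSome_insub.
Qed.

Lemma edge_mult_right i j :
  edge_mult (i, j) (i.+1, j) = if j == 0 then 2 else 1.
Proof. by rewrite /edge_mult eqxx. Qed.

Lemma edge_mult_up i j :
  edge_mult (i, j) (i, j.+1) = if i == 0 then 3 else 1.
Proof. by rewrite /edge_mult !xpair_eqE /= !eqxx (ltn_eqF (ltnSn i)). Qed.

Lemma edge_mult_diag i j : edge_mult (i, j) (i.+1, j.+1) = 1.
Proof.
by rewrite /edge_mult !xpair_eqE /= !eqxx (gtn_eqF (ltnSn i)) (gtn_eqF (ltnSn j)).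
Qed.

Lemma edge_ex (v w : vertex) : 0 < edge_mult v w ->
  exists e : edge, source e = v /\ target e = w.
Proof. by move=> vw; exists (@Edge ((v, w), 0) vw). Qed.

Lemma segment_ex v : exists2 s, segment s & segment_end s = v.
Proof.
case: v => n k.
have step s w : segment s -> 0 < edge_mult (segment_end s) w ->
    exists2 s, segment s & segment_end s = w.
  move=> ss /edge_ex[e [es et]]; exists (rcons s e).
    by rewrite segment_rcons ss es eqxx.
  by rewrite segment_end_rcons.
elim: k => [|k [s ss sk]]; last first.
  by apply: (step _ _ ss); rewrite sk edge_mult_up; case: ifP.
elim: n => [|n [s ss sn]]; first by exists [::].
by apply: (step _ _ ss); rewrite sn edge_mult_right.
Qed.

Lemma cylinder_split s :
  cylinder s = \bigcup_(e in [set` out_edges (segment_end s)]) cylinder (rcons s e).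
Proof.
apply/seteqP; split=> x.
  move=> sx; exists (x (size s)); last by rewrite cylinder_rcons.
  by rewrite /= mem_out_edges; apply/eqP; exact: cylinder_end.
by move=> [e _]; rewrite cylinder_rcons => -[].
Qed.

(** * The boundary odometers *)

Lemma X_horE : X_hor = ~` [set x | exists n, (vertex_at x n).2 != 0].
Proof.
apply/seteqP; split=> x /= hx; first by move=> [n]; rewrite hx.
by move=> n; apply/eqP/negP => /negP h; apply: hx; exists n.
Qed.

Lemma X_verE : X_ver = ~` [set x | exists n, (vertex_at x n).1 != 0].
Proof.
apply/seteqP; split=> x /= hx; first by move=> [n]; rewrite hx.
by move=> n; apply/eqP/negP => /negP h; apply: hx; exists n.
Qed.

Lemma measurable_X_hor : measurable X_hor.
Proof.
rewrite X_horE; apply: measurableC.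
exact: (@measurable_visit [set v | v.2 != 0]).
Qed.

Lemma measurable_X_ver : measurable X_ver.
Proof.
rewrite X_verE; apply: measurableC.
exact: (@measurable_visit [set v | v.1 != 0]).
Qed.

Lemma hor_ver_interior (x : X) : (X_hor `|` X_ver `|`
  [set x | exists n, (vertex_at x n).1 != 0 /\ (vertex_at x n).2 != 0]) x.
Proof.
have [xh|] := pselect (X_hor x); first by left; left.
have [xv|] := pselect (X_ver x); first by left; right.
rewrite X_horE X_verE => /contrapT[m hm] /contrapT[n hn]; right.
exists (maxn m n).
have [_] := vertex_at_mono x (leq_maxr m n).
have [] := vertex_at_mono x (leq_maxl m n).
move: hm hn; rewrite -!lt0n => hm hn h1 h2.
by split; [exact: leq_trans hm _ | exact: leq_trans hn _].
Qed.

(** * Weights of invariant measures *)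

Section weights.
Context {R : realType}.
Local Open Scope ring_scope.
Local Open Scope ereal_scope.

(** The condition of [invariant_measure], for an arbitrary set function instead of
a probability measure. *)
Definition tail_invariant (m : set X -> \bar R) : Prop :=
  forall s t, segment s -> segment t -> segment_end s = segment_end t ->
    m (cylinder s) = m (cylinder t).

Variable m : {measure set X -> \bar R}.
Hypotheses (m_fin : m setT < +oo) (m_inv : tail_invariant m).

Lemma cylinder_fin s : m (cylinder s) \is a fin_num.
Proof.
rewrite ge0_fin_numE ?measure_ge0 //; apply: le_lt_trans m_fin.
by apply: le_measure => //; apply/mem_set => //; exact: measurable_cylinder.
Qed.

(** [w] is the common measure of the cylinders that end at a given vertex. *)
Lemma weight_ex : exists w : nat -> nat -> R,
  [/\ forall s, segment s -> m (cylinder s) = (w (segment_end s).1 (segment_end s).2)%:E,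
      forall i j, (0 <= w i j)%R, (w 0 0)%:E = m setT & harmonic 2 3 w].
Proof.
pose S v : seq edge := s2val (cid2 (segment_ex v)).
have Sseg v : segment (S v) by rewrite /S; case: cid2.
have Send v : segment_end (S v) = v by rewrite /S; case: cid2.
pose W v : R := fine (m (cylinder (S v))).
have mW s : segment s -> m (cylinder s) = (W (segment_end s))%:E.
  move=> ss; rewrite fineK ?cylinder_fin //; apply: m_inv => //.
exists (fun i j => W (i, j)); split.
- by move=> s ss; rewrite mW // -surjective_pairing.
- by move=> i j; rewrite fine_ge0 ?measure_ge0.
- by rewrite -cylinder_nil mW.
move=> i j; have e1 := mW _ (Sseg (i, j)); move: e1.
rewrite cylinder_split measure_fin_bigcup //; first last.
- by move=> e _; exact: measurable_cylinder.
- move=> e f _ _ [x []]; rewrite !cylinder_rcons => -[_ /= <-] [_ /= <-] //.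
- exact: finite_seq.
rewrite -fsbig_seq ?uniq_out_edges // !Send.
rewrite (eq_big_seq (fun e => (W (target e))%:E)); last first.
  move=> e; rewrite mem_out_edges => /eqP es.
  by apply: (etrans (mW _ _)); rewrite ?segment_end_rcons // segment_rcons Sseg Send es eqxx.
rewrite sumEFin sum_out_edges !big_cons big_nil => -[<-].
rewrite edge_mult_right edge_mult_up edge_mult_diag.
by case: i j => [|i] [|j] //=; ring.
Qed.

Lemma interior_null :
  m [set x | exists n, (vertex_at x n).1 != 0%N /\ (vertex_at x n).2 != 0%N] = 0.
Proof.
have [w [mw w_ge0 _ hw]] := weight_ex.
apply: (@visit_null _ _ [set v | v.1 != 0%N /\ v.2 != 0%N]) => s ss [h1 h2].
by rewrite mw // -(prednK (n := (segment_end s).1)) ?lt0n //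
  -(prednK (n := (segment_end s).2)) ?lt0n // harmonic_interior.
Qed.

(** Off the horizontal axis the weights vanish, and along it harmonicity halves
them at each step. *)
Lemma hor_weight : m (~` X_hor) = 0 -> forall s, segment s ->
  m (cylinder s) =
  m setT * (if (segment_end s).2 == 0%N then 2 ^- (segment_end s).1 else 0)%:E.
Proof.
move=> mhor; have [w [mw w_ge0 w00 hw]] := weight_ex.
have w0 i j : w i j.+1 = 0%R.
  have [s ss sE] := segment_ex (i, j.+1).
  have : m (cylinder s) = 0.
    apply: (subset_measure0 _ _ _ mhor).
    - exact: measurable_cylinder.
    - by apply: measurableC; exact: measurable_X_hor.
    - by move=> x /cylinder_end + /(_ (size s)) => ->; rewrite sE.
  by rewrite mw // sE => -[].
have wi i : (w i 0%N = w 0%N 0%N * 2 ^- i)%R.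
  elim: i => [|i IH]; first by rewrite expr0 invr1 mulr1.
  have := hw i 0%N; rewrite !w0 mulr0 !addr0 IH /= => h.
  by rewrite exprS invfM mulrCA h; field.
move=> s ss; rewrite mw // -w00 -EFinM.
by case: (segment_end s) => i [|j] /=; rewrite ?w0 ?mulr0 // wi.
Qed.

(** Off the vertical axis the weights vanish, and along it harmonicity divides
them by 3 at each step. *)
Lemma ver_weight : m (~` X_ver) = 0 -> forall s, segment s ->
  m (cylinder s) =
  m setT * (if (segment_end s).1 == 0%N then 3 ^- (segment_end s).2 else 0)%:E.
Proof.
move=> mver; have [w [mw w_ge0 w00 hw]] := weight_ex.
have w0 i j : w i.+1 j = 0%R.
  have [s ss sE] := segment_ex (i.+1, j).
  have : m (cylinder s) = 0.
    apply: (subset_measure0 _ _ _ mver).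
    - exact: measurable_cylinder.
    - by apply: measurableC; exact: measurable_X_ver.
    - by move=> x /cylinder_end + /(_ (size s)) => ->; rewrite sE.
  by rewrite mw // sE => -[].
have wj j : (w 0%N j = w 0%N 0%N * 3 ^- j)%R.
  elim: j => [|j IH]; first by rewrite expr0 invr1 mulr1.
  have := hw 0%N j; rewrite !w0 mulr0 addr0 add0r IH /= => h.
  by rewrite exprS invfM mulrCA h; field.
move=> s ss; rewrite mw // -w00 -EFinM.
by case: (segment_end s) => -[|i] j /=; rewrite ?w0 ?mulr0 // wj.
Qed.

Lemma boundary_full : m X_hor = 0 -> m X_ver = 0 -> m setT = 0.
Proof.
move=> mhor mver; apply/negligibleP; first exact: measurableT.
pose V : set X := [set x | exists n, (vertex_at x n).1 != 0%N /\ (vertex_at x n).2 != 0%N].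
apply: (@negligibleS _ _ _ _ ((X_hor `|` X_ver) `|` V)); last first.
  apply: negligibleU; last first.
    apply/negligibleP; last exact: interior_null.
    exact: (@measurable_visit [set v | v.1 != 0%N /\ v.2 != 0%N]).
  apply: negligibleU; apply/negligibleP => //.
  - exact: measurable_X_hor.
  - exact: measurable_X_ver.
move=> x _; exact: hor_ver_interior.
Qed.

End weights.

(** * Digits under Lebesgue measure *)

Section unit_interval.
Context {R : realType}.
Local Open Scope ring_scope.

Lemma truncn_mul_nat (x : R) b : (0 < b)%N -> 0 <= x ->
  Num.truncn x = (Num.truncn (x * b%:R) %/ b)%N.
Proof.
move=> b0 x0; set m := Num.truncn (x * _).
have /andP[mx xm] : m%:R <= x * b%:R < m.+1%:R by rewrite truncn_itv ?mulr_ge0.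
have bR : 0 < b%:R :> R by rewrite ltr0n.
apply: truncn_def; apply/andP; split.
  rewrite -(ler_pM2r bR); apply: le_trans mx.
  by rewrite -natrM ler_nat leq_divM.
rewrite -(ltr_pM2r bR); apply: lt_le_trans xm _.
by rewrite -natrM ler_nat ltn_ceil.
Qed.

Lemma measurable_truncn_mul (c : R) (Q : set nat) : 0 < c ->
  measurable [set x : measurableTypeR R | Q (Num.truncn (x * c))].
Proof.
move=> c0.
have mlt k : measurable [set x : measurableTypeR R | (k < Num.truncn (x * c)%R)%N].
  rewrite (_ : [set _ | _] = `[(k.+1%:R / c), +oo[%classic).
    exact: measurable_itv.
  apply/seteqP; split=> x /=; rewrite in_itv /= andbT truncn_gt_nat;
    by rewrite ler_pdivrMr.
have meq k : measurable [set x : measurableTypeR R | Num.truncn (x * c) = k].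
  case: k => [|k].
    rewrite (_ : [set _ | _] = ~` [set x | (0 < Num.truncn (x * c)%R)%N]).
      by apply: measurableC.
    by apply/seteqP; split=> x /=; lia.
  rewrite (_ : [set _ | _] = [set x | (k < Num.truncn (x * c)%R)%N] `\`
                             [set x | (k.+1 < Num.truncn (x * c)%R)%N]).
    exact: measurableD.
  by apply/seteqP; split=> x /=; lia.
rewrite (_ : [set _ | _] =
    \bigcup_(k in Q) [set x | Num.truncn (x * c) = k]).
  by apply: bigcup_measurable.
apply/seteqP; split=> [x Qx|x [k Qk /= ->] //]; by exists (Num.truncn (x * c)).
Qed.

(** Lebesgue measure restricted to the interval from 0 included to 1 excluded, as a
probability measure on the whole line. *)
Definition unit_measure : set (measurableTypeR R) -> \bar R :=
  mrestr lebesgue_measure (measurable_itv `[0%R, 1%R[).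

HB.instance Definition _ := Measure.on unit_measure.

Let unit_measureT : unit_measure setT = 1%E.
Proof.
by rewrite /unit_measure /mrestr setTI lebesgue_measure_itv /= lte_fin ltr01 oppr0 adde0.
Qed.

HB.instance Definition _ :=
  Measure_isProbability.Build _ _ _ unit_measure unit_measureT.

(** The set consists, within the unit interval, of the numbers whose first [n]
digits in base [b] form the number [k]. *)
Lemma unit_measure_truncn b n k : (0 < b)%N -> (k < b ^ n)%N ->
  unit_measure [set x | Num.truncn (x * b%:R ^+ n) = k] = (b%:R ^- n)%:E.
Proof.
move=> b0 kn; have bR : 0 < b%:R ^+ n :> R by rewrite exprn_gt0 ?ltr0n.
rewrite /unit_measure /mrestr.
have e : (k.+1%:R / b%:R ^+ n) - (k%:R / b%:R ^+ n) = b%:R ^- n :> R.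
  by rewrite -mulrBl -natrB // subSnn mul1r.
rewrite (_ : _ `&` _ = `[k%:R / b%:R ^+ n, k.+1%:R / b%:R ^+ n[%classic).
  rewrite lebesgue_measure_itv /= lte_fin ltr_pM2r ?invr_gt0 // ltr_nat ltnSn.
  by rewrite -EFinD e.
apply/seteqP; split=> x /=; rewrite !in_itv /=.
  move=> [<- /andP[x0 _]]; rewrite ler_pdivrMr // ltr_pdivlMr //.
  by rewrite truncn_itv // mulr_ge0 // ltW.
rewrite ler_pdivrMr // ltr_pdivlMr // => /andP[kx xk].
split; first by apply: truncn_def; rewrite kx.
apply/andP; split.
  by rewrite -(pmulr_lge0 _ bR); apply: le_trans kx.
rewrite -(ltr_pM2r bR) mul1r; apply: lt_le_trans xk _.
by rewrite -natrX ler_nat.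
Qed.

End unit_interval.

(** * Measures on rays *)

(** A ray from the root: [b] edges lead from each vertex [v n] to the next one,
and no other edge enters the ray. *)
Record ray (b : nat) (v : nat -> vertex) : Prop := Ray {
  ray0 : v 0 = root;
  ray_mult : forall n, edge_mult (v n) (v n.+1) = b;
  ray_source : forall (e : edge) n, target e = v n.+1 -> source e = v n }.

Lemma hor_ray : ray 2 (fun n => (n, 0)).
Proof.
split=> // [n|e n en]; first by rewrite edge_mult_right.
by case: (edgeP e); rewrite en => -[]; case: (source e) => i j //= -> <-.
Qed.

Lemma ver_ray : ray 3 (fun n => (0, n)).
Proof.
split=> // [n|e n en]; first by rewrite edge_mult_up.
by case: (edgeP e); rewrite en => -[]; case: (source e) => i j //= <- ->.
Qed.

Section ray_measure.
Context {R : realType}.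
Variables (b : nat) (v : nat -> vertex).
Hypotheses (b0 : 0 < b) (hv : ray b v).

Lemma ray_edge_subproof n d : d %% b < edge_mult (v n) (v n.+1).
Proof. by rewrite (ray_mult hv) ltn_pmod. Qed.

(** The edge of the ray that leaves [v n] with index [d] modulo [b]. *)
Definition ray_edge n d : edge :=
  @Edge ((v n, v n.+1), d %% b) (ray_edge_subproof n d).

Lemma ray_path_ex (d : nat -> nat) :
  exists x : npath, forall n, x n = ray_edge n (d n).
Proof.
have h0 : source (ray_edge 0 (d 0)) = root by exact: (ray0 hv).
have hS i : adjacent (ray_edge i (d i)) (ray_edge i.+1 (d i.+1)) by exact: eqxx.
by exists (@NPath (fun n => ray_edge n (d n)) h0 hS).
Qed.

Lemma ray_neq_root n : v n.+1 <> root.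
Proof. by have [] := edgeP (ray_edge n 0); rewrite /target /= => ->. Qed.

Local Open Scope ring_scope.

(** The path along the ray that chooses its edges by the base [b] digits of a
number: the digit of rank [n + 1] is the integral part of [x * b^(n + 1)] modulo
[b].  Only the values on the unit interval matter. *)
Definition digit_path (x : measurableTypeR R) : X :=
  sval (cid (ray_path_ex (fun n => Num.truncn (x * b%:R ^+ n.+1)))).

Lemma digit_pathE x n : (digit_path x : npath) n =
  ray_edge n (Num.truncn (x * b%:R ^+ n.+1)).
Proof. by rewrite /digit_path; case: cid. Qed.

Lemma vertex_at_digit_path x n : vertex_at (digit_path x) n = v n.
Proof. by rewrite /vertex_at digit_pathE. Qed.

Lemma measurable_digit_path : measurable_fun setT digit_path.
Proof.
apply: measurable_fun_cylinder => s _; elim/last_ind: s => [|s e IH].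
  by rewrite cylinder_nil preimage_setT.
rewrite cylinder_rcons preimage_setI; apply: measurableI => //.
rewrite (_ : _ @^-1` _ = [set x : measurableTypeR R |
  [set d | ray_edge (size s) d = e] (Num.truncn (x * b%:R ^+ (size s).+1))]).
  by apply: measurable_truncn_mul; rewrite exprn_gt0 // ltr0n.
by apply/seteqP; split=> x /=; rewrite digit_pathE.
Qed.

(** The cylinder of a segment that ends on the ray prescribes the first [n] digits. *)
Lemma digit_path_cylinder s n : segment s -> segment_end s = v n ->
  exists2 k, (k < b ^ n)%N & forall x : R, 0 <= x < 1 ->
    cylinder s (digit_path x) <-> Num.truncn (x * b%:R ^+ n) = k.
Proof.
suff H : segment s -> segment_end s = v n -> size s = n /\
    exists2 k, (k < b ^ n)%N & forall x : R, 0 <= x < 1 ->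
    cylinder s (digit_path x) <-> Num.truncn (x * b%:R ^+ n) = k.
  by move=> ss sn; have [] := H ss sn.
elim/last_ind: s n => [|s e IH] [|n].
- move=> _ _; split=> //; exists 0%N => // x x0.
  by rewrite cylinder_nil expr0 mulr1; split=> // _; exact: truncn_def.
- by move=> _ /esym/ray_neq_root.
- rewrite segment_end_rcons (ray0 hv) => _.
  by have [] := edgeP e => ->.
rewrite segment_rcons segment_end_rcons => /andP[ss /eqP es] et.
have en := ray_source hv et.
have [sn [k kb hk]] := IH n ss (etrans (esym es) en).
have eb : ((edge_val e).2 < b)%N.
  by rewrite -(ray_mult hv n) -en -et; exact: (edge_valP e).
split; first by rewrite size_rcons sn.
exists (k * b + (edge_val e).2)%N.
  by rewrite expnSr; nia.
move=> x x01; have /andP[x0 _] := x01; rewrite cylinder_rcons.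
have hd : Num.truncn (x * b%:R ^+ n) = (Num.truncn (x * b%:R ^+ n.+1) %/ b)%N.
  by rewrite exprSr mulrA; apply: truncn_mul_nat => //; rewrite mulr_ge0 ?exprn_ge0.
set m := Num.truncn (x * b%:R ^+ n.+1) in hd *.
have he : ((digit_path x : npath) (size s) = e) <-> (m %% b = (edge_val e).2)%N.
  rewrite digit_pathE sn -/m; split=> [<- //|h].
  by apply: edge_ext; rewrite ?en ?et.
split=> [[/(hk x x01) h /he h']|h].
  by rewrite (divn_eq m b) -hd h h'.
split; first by apply/(hk x x01); rewrite hd h divnMDl // divn_small // addn0.
by apply/he; rewrite h modnMDl modn_small.
Qed.

(** Coin tossing along the ray, an invariant measure carried by it: the cylinder of
a segment that ends at [v n] has measure [b^-n], every cylinder that ends off the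
ray has measure zero. *)
Lemma ray_measure_ex : exists mu : probability X R,
  invariant_measure mu /\
  forall Y : set X, (forall x : npath, (forall n, vertex_at x n = v n) -> Y x) ->
    mu Y = 1%E.
Proof.
pose f : {mfun measurableTypeR R >-> X} :=
  HB.pack digit_path (isMeasurableFun.Build _ _ _ _ _ measurable_digit_path).
exists (distribution (@unit_measure R) f); split; last first.
  move=> Y hY; rewrite /distribution /pushforward /=.
  rewrite (_ : _ @^-1` Y = setT) ?probability_setT //.
  by apply/seteqP; split=> // x _; apply: hY; exact: vertex_at_digit_path.
have on_ray s n : segment s -> segment_end s = v n ->
    distribution (@unit_measure R) f (cylinder s) = (b%:R ^- n)%:E.
  move=> ss sn; have [k kb hk] := digit_path_cylinder ss sn.
  rewrite -(unit_measure_truncn b0 kb) /distribution /pushforward /=.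
  rewrite /unit_measure /mrestr; congr (lebesgue_measure _).
  apply/seteqP; split=> x /= [h xI]; split=> //.
    by apply/hk.
  by apply/hk.
have off_ray s : (forall n, segment_end s <> v n) ->
    distribution (@unit_measure R) f (cylinder s) = 0%E.
  move=> sv; rewrite /distribution /pushforward /=.
  rewrite (_ : _ @^-1` _ = set0) ?measure0 //.
  apply/seteqP; split=> // x /cylinder_end /esym.
  by rewrite vertex_at_digit_path; exact: sv.
move=> s t ss st se.
have [[n sn]|ns] := pselect (exists n, segment_end s = v n).
  exact: etrans (on_ray s n ss sn) (esym (on_ray t n st (etrans (esym se) sn))).
by apply: etrans (off_ray s _) (esym (off_ray t _)) => n h;
  apply: ns; exists n; rewrite // se.
Qed.

End ray_measure.

(** * Exchanging initial segments *)

Lemma npath_of_segments (f : nat -> edge) :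
  (forall n, segment (mkseq f n)) -> exists y : npath, edge_at y = f.
Proof.
move=> fs.
have f0 : source (f 0) = root by have := fs 1; rewrite /= andbT => /eqP.
have fS i : adjacent (f i) (f i.+1).
  have := fs i.+2; rewrite mkseqS segment_rcons => /andP[_].
  by rewrite mkseqS segment_end_rcons.
by exists (NPath f0 fS).
Qed.

Lemma segment_take s n : segment s -> segment (take n s).
Proof.
elim/last_ind: s => [//|s e IH] in n *; rewrite segment_rcons => /andP[ss es].
case: (leqP n (size s)) => [ns|sn].
  by rewrite -cats1 takel_cat // IH.
by rewrite take_oversize ?size_rcons // segment_rcons ss.
Qed.

Lemma segment_end_cat s t r : segment_end s = segment_end t ->
  segment_end (s ++ r) = segment_end (t ++ r).
Proof.
move=> st; elim/last_ind: r => [|r e _]; first by rewrite !cats0.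
by rewrite -!rcons_cat !segment_end_rcons.
Qed.

Lemma segment_cat s t r : segment s -> segment_end s = segment_end t ->
  segment (t ++ r) -> segment (s ++ r).
Proof.
move=> ss st; elim/last_ind: r => [|r e IH]; first by rewrite !cats0.
rewrite -!rcons_cat !segment_rcons => /andP[/IH -> /eqP ->].
by rewrite (segment_end_cat r st) eqxx.
Qed.

(** The path that follows [t] and then the path [x] from its [n]-th vertex on. *)
Lemma graft_ex t n (x : npath) : segment t -> vertex_at x n = segment_end t ->
  exists y : npath, cylinder t y /\ forall i, y (size t + i) = x (n + i).
Proof.
move=> st xn.
pose f i := if i < size t then nth (x 0) t i else x (n + (i - size t)).
have ft : mkseq f (size t) = t.
  apply: (@eq_from_nth _ (x 0)); rewrite size_mkseq // => i it.
  by rewrite nth_mkseq // /f it.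
have fk k : mkseq f (size t + k) = t ++ mkseq (fun j => x (n + j)) k.
  rewrite /mkseq iotaD map_cat -/(mkseq _ _) ft add0n; congr (_ ++ _).
  rewrite -[X in iota X _]addn0 iotaDl -map_comp; apply: eq_map => j /=.
  by rewrite /f ltnNge leq_addr /= addKn.
have [] := @npath_of_segments f.
  move=> m; case: (leqP m (size t)) => [mt|/ltnW/subnKC <-].
    have -> : mkseq f m = take m t.
      by rewrite -[in RHS]ft /mkseq -map_take take_iota (minn_idPl mt).
    exact: segment_take.
  rewrite fk; elim: (m - size t) => [|k IH]; first by rewrite cats0.
  rewrite mkseqS -rcons_cat segment_rcons IH; apply/eqP.
  case: k {IH} => [|k]; first by rewrite cats0 addn0.
  by rewrite mkseqS -rcons_cat segment_end_rcons addnS -vertex_atS.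
move=> y yf; exists y; rewrite /cylinder /= yf; split=> // i.
by rewrite /f ltnNge leq_addr /= addKn.
Qed.

Lemma tail_equiv_graft x y t n : vertex_at x n = segment_end t ->
  cylinder t y -> (forall i, y (size t + i) = x (n + i)) -> tail_equiv x y.
Proof.
move=> xn /cylinder_end ty yx; exists n, (size t); split; first by rewrite xn ty.
by move=> i; rewrite yx.
Qed.

(** A measurable self-map of the path space that carries the cylinder of any
segment of length [n] ending where [t] ends onto the cylinder of [t], by
replacing the initial segment with [t]. *)
Lemma graft_map_ex t n : segment t -> exists g : X -> X,
  [/\ measurable_fun setT g,
      forall x : X, vertex_at x n = segment_end t -> cylinder t (g x),
      forall x : X, vertex_at x n = segment_end t ->
        forall i, (g x : npath) (size t + i) = (x : npath) (n + i)
    & forall x : X, vertex_at x n = segment_end t -> tail_equiv x (g x)].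
Proof.
move=> st.
have H (x : npath) : exists y : npath, if vertex_at x n == segment_end t then
    cylinder t y /\ (forall i, y (size t + i) = x (n + i)) else y = x.
  by case: eqP => [/(graft_ex st)//|_]; exists x.
have [g hg] := choice H.
have g1 x : vertex_at x n = segment_end t ->
    cylinder t (g x) /\ (forall i, g x (size t + i) = x (n + i)).
  by move=> h; have := hg x; rewrite h eqxx.
have g2 x : vertex_at x n != segment_end t -> g x = x.
  by move=> h; have := hg x; rewrite (negbTE h).
exists g; split; last 1 first.
- by move=> x xn; have [] := g1 x xn; exact: tail_equiv_graft.
- apply: measurable_fun_cylinder => u _.
  apply: measurable_cylinder_union => x /= xu.
  exists (n + size u).+1 => y; rewrite /cylinder /mkset size_mkseq => yx.
  have yxi i : i <= n + size u -> y i = x i.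
    move=> iN; have := congr1 (fun s => nth (x 0) s i) yx.
    by rewrite !nth_mkseq.
  have yn : vertex_at y n = vertex_at x n by rewrite /vertex_at yxi // leq_addr.
  suff e : mkseq (g y) (size u) = mkseq (g x) (size u).
    by rewrite /preimage /cylinder /mkset e.
  apply/eq_in_map => i; rewrite mem_iota /= add0n => iu.
  case: (eqVneq (vertex_at x n) (segment_end t)) => [h|h]; last first.
    by rewrite !g2 ?yn // yxi // ltnW // ltn_addl.
  have [tx gx] := g1 x h; have [ty gy] := g1 y (etrans yn h).
  case: (ltnP i (size t)) => it.
    have := congr1 (fun s => nth (x 0) s i) (etrans ty (esym tx)).
    by rewrite !nth_mkseq.
  by rewrite -(subnKC it) gx gy yxi // leq_add2l; lia.
- by move=> x /g1[].
- by move=> x /g1[].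
Qed.

Section exchange.
Context {R : realType}.
Local Open Scope ring_scope.
Local Open Scope ereal_scope.
Variable m : {measure set X -> \bar R}.
Hypotheses (m_fin : m setT < +oo) (m_inv : tail_invariant m).

(** Replacing an initial segment [s] by a segment [t] with the same end preserves
an invariant measure. *)
Lemma exchange_measure s t (g : X -> X) : segment s -> segment t ->
  segment_end s = segment_end t -> measurable_fun setT g ->
  (forall x : X, cylinder s x -> cylinder t (g x)) ->
  (forall x : X, cylinder s x ->
     forall i, (g x : npath) (size t + i)%N = (x : npath) (size s + i)%N) ->
  forall B, measurable B -> m (cylinder s `&` g @^-1` B) = m (cylinder t `&` B).
Proof.
move=> ss ts st mg gt gi B mB.
have ms := measurable_cylinder s; have mt := measurable_cylinder t.
(* the structure of measure on an image set function is parametrized by a proof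
of measurability, hence given explicitly *)
pose m1 : {measure set X -> \bar R} :=
  measure_function_pushforward__canonical__measure_function_Measure
    (mrestr m ms) mg.
rewrite setIC [X in _ = m X]setIC -[RHS]/(mrestr m mt B).
rewrite -[LHS]/(m1 B).
apply: eq_cylinder_measure => // [|u uu].
  rewrite /m1 /= /pushforward /mrestr /= preimage_setT setTI.
  by rewrite ltey_eq cylinder_fin.
rewrite /m1 /= /pushforward /mrestr /=.
(* [u] is a prefix of [t], or extends [t], or its cylinder misses that of [t] *)
have [/prefixP[r tE]|npu] := boolP (prefix u t).
  rewrite (_ : g @^-1` cylinder u `&` cylinder s = cylinder s); last first.
    apply/setIidPr => x /gt; apply: cylinder_sub.
    by rewrite tE prefix_prefix.
  rewrite (_ : cylinder u `&` cylinder t = cylinder t) ?(m_inv ss ts) //.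
  by apply/setIidPr/cylinder_sub; rewrite tE prefix_prefix.
have [/prefixP[r uE]|npt] := boolP (prefix t u); last first.
  have e0 x : cylinder t x -> cylinder u x -> False.
    move=> tx ux; case: (leqP (size t) (size u)) => [|/ltnW] tu.
      by have := cylinder_disjoint tu tx ux; rewrite (negbTE npt).
    by have := cylinder_disjoint tu ux tx; rewrite (negbTE npu).
  rewrite (_ : _ `&` cylinder s = set0); last first.
    by apply/seteqP; split=> // x [/= gu /gt gx]; apply: e0 gx gu.
  rewrite (_ : cylinder u `&` cylinder t = set0) //.
  by apply/seteqP; split=> // x [/= ux tx]; apply: e0 tx ux.
have -> : cylinder u `&` cylinder t = cylinder u.
  by apply/setIidPl/cylinder_sub; rewrite uE prefix_prefix.
have -> : g @^-1` cylinder u `&` cylinder s = cylinder (s ++ r).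
  have mkcat (x : npath) a b :
      mkseq x (a + b) = mkseq x a ++ mkseq (fun j => x (a + j)%N) b.
    rewrite /mkseq iotaD map_cat add0n; congr (_ ++ _).
    by rewrite -[X in iota X _]addn0 iotaDl -map_comp.
  apply/seteqP; split=> x; rewrite /cylinder /= uE !size_cat !mkcat.
    move=> [gu sx]; have tx : mkseq (g x : npath) (size t) = t by exact: gt.
    move: gu; rewrite tx sx => /eqP; rewrite eqseq_cat // eqxx /= => /eqP {2}<-.
    by congr (_ ++ _); apply: eq_map => j; rewrite gi.
  move=> /eqP; rewrite eqseq_cat ?size_mkseq // => /andP[/eqP sx /eqP rx].
  split=> //; have tx : mkseq (g x : npath) (size t) = t by exact: gt.
  rewrite tx -{2}rx; congr (_ ++ _).
  by apply: eq_map => j; rewrite gi.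
rewrite uE in uu *; apply: m_inv => //; last exact: segment_end_cat.
exact: segment_cat uu.
Qed.

(** The restriction of an invariant measure to a union of tail classes is again
invariant. *)
Lemma restrict_invariant (A : set X) (mA : measurable A) :
  (forall x y : X, tail_equiv x y -> A x <-> A y) ->
  tail_invariant (mrestr m mA).
Proof.
move=> Atail s t ss ts st; rewrite /mrestr.
have [g [mg gt gi gtail]] := graft_map_ex (size s) ts.
rewrite -(exchange_measure (g := g) ss ts st mg _ _ mA).
- congr (m _); apply/seteqP; split=> x [sx Ax]; split=> //.
    by apply/(Atail x); first apply: gtail; rewrite ?(cylinder_end sx).
  by apply/(Atail x (g x)) => //; apply: gtail; rewrite ?(cylinder_end sx).
- by move=> x /cylinder_end xs; apply: gt; rewrite xs.
- by move=> x /cylinder_end xs; apply: gi; rewrite xs.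
Qed.

End exchange.

(** * Ergodic measures *)

Lemma tail_equiv_refl x : tail_equiv x x.
Proof. by exists 0, 0. Qed.

Lemma tail_equiv_sym x y : tail_equiv x y -> tail_equiv y x.
Proof. by move=> [m [n [e h]]]; exists n, m; split=> // i; rewrite h. Qed.

Lemma tail_equiv_trans x y z :
  tail_equiv x y -> tail_equiv y z -> tail_equiv x z.
Proof.
move=> [m [n [_ xy]]] [p [q [_ yz]]].
have xz i : x (m + p + i) = z (q + n + i).
  by rewrite -addnA xy addnCA yz addnA.
by exists (m + p), (q + n); split=> //; have := xz 0; rewrite !addn0 /vertex_at => ->.
Qed.

Lemma tail_saturated (C : set npath) x y : tail_equiv x y ->
  (\bigcup_(z in C) tail_class z) x <-> (\bigcup_(z in C) tail_class z) y.
Proof.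
move=> xy; split=> -[z Cz zx]; exists z => //; apply: tail_equiv_trans zx _ => //.
exact: tail_equiv_sym.
Qed.

(** Paths do not return to an axis they have left. *)
Lemma X_hor_saturated : X_hor = \bigcup_(x in X_hor) tail_class x.
Proof.
apply/seteqP; split=> [x xh|y [x xh [m [n [_ xy]]]] i].
  by exists x => //; exact: tail_equiv_refl.
have [_] := vertex_at_mono y (leq_addl n i).
by rewrite /vertex_at -xy -/(vertex_at x (m + i)) xh leqn0 => /eqP.
Qed.

Lemma X_ver_saturated : X_ver = \bigcup_(x in X_ver) tail_class x.
Proof.
apply/seteqP; split=> [x xh|y [x xh [m [n [_ xy]]]] i].
  by exists x => //; exact: tail_equiv_refl.
have [+ _] := vertex_at_mono y (leq_addl n i).
by rewrite /vertex_at -xy -/(vertex_at x (m + i)) xh leqn0 => /eqP.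
Qed.

Section rigid.
Context {R : realType}.
Local Open Scope ring_scope.
Local Open Scope ereal_scope.

(** [Y] is rigid when an invariant measure carried by [Y] is determined by its
total mass, through weights [p] of the vertices. *)
Definition rigid (Y : set X) (p : vertex -> R) : Prop :=
  forall m : {measure set X -> \bar R}, m setT < +oo -> tail_invariant m ->
    m (~` Y) = 0 -> forall s, segment s ->
    m (cylinder s) = m setT * (p (segment_end s))%:E.

Variables (Y : set X) (p : vertex -> R).
Hypotheses (mY : measurable Y) (hY : rigid Y p).

Let probability_fin (mu : probability X R) : mu setT < +oo.
Proof. by rewrite probability_setT ltey. Qed.

Let null_compl (mu : probability X R) : mu Y = 1 -> mu (~` Y) = 0.
Proof. by move=> muY; rewrite probability_setC // muY subee. Qed.

Lemma rigid_unique (mu nu : probability X R) :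
  invariant_measure mu -> invariant_measure nu -> mu Y = 1 -> nu Y = 1 ->
  same_measure nu mu.
Proof.
move=> imu inu muY nuY; apply: eq_cylinder_measure => [|s ss]; first exact: probability_fin.
rewrite (hY (probability_fin nu) inu (null_compl nuY) ss).
rewrite (hY (probability_fin mu) imu (null_compl muY) ss); congr (_ * _).
exact: etrans (probability_setT nu) (esym (probability_setT mu)).
Qed.

(** For an invariant set [A], the restriction of [mu] to [A] is proportional to
[mu], so that [A] is independent of itself. *)
Lemma rigid_ergodic (mu : probability X R) :
  invariant_measure mu -> mu Y = 1 -> ergodic_measure mu.
Proof.
move=> imu muY A mA [C AC].
have iA : tail_invariant (mrestr mu mA).
  apply: (restrict_invariant (probability_fin mu) imu) => x y; rewrite AC.
  exact: tail_saturated.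
have muA : (fine (mu A))%:E = mu A by rewrite fineK // fin_num_measure.
pose c : {nonneg R} := NngNum (fine_ge0 (measure_ge0 mu A)).
have indep B : measurable B -> mrestr mu mA B = mscale c mu B.
  apply: eq_cylinder_measure => [|s ss].
    rewrite /= /mrestr setTI; apply: le_lt_trans (probability_le1 mu mA) _.
    exact: ltey.
  rewrite hY //; first 1 last.
  - by rewrite /= /mrestr setTI; apply: le_lt_trans (probability_le1 mu mA) _; exact: ltey.
  - rewrite /= /mrestr; apply: (subset_measure0 _ _ _ (null_compl muY)) => //.
    + by apply: measurableI => //; exact: measurableC.
    + exact: measurableC.
  rewrite /= /mrestr /mscale setTI (hY (probability_fin mu) imu (null_compl muY) ss).
  rewrite muA; congr (_ * _).
  by rewrite -[LHS]mul1e; congr (_ * _); exact/esym/probability_setT.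
have := indep A mA; rewrite /mrestr /mscale /= setIid -muA /= -EFinM => -[h].
have /eqP : (fine (mu A) * (fine (mu A) - 1) = 0)%R by rewrite mulrBr mulr1 -h subrr.
by rewrite mulf_eq0 subr_eq0 => /orP[/eqP->|/eqP->]; [left | right].
Qed.

End rigid.

Lemma rigid_hor (R : realType) : @rigid R X_hor
  (fun v => if v.2 == 0 then 2 ^- v.1 else 0)%R.
Proof. by move=> m m_fin m_inv mhor s ss; rewrite hor_weight. Qed.

Lemma rigid_ver (R : realType) : @rigid R X_ver
  (fun v => if v.1 == 0 then 3 ^- v.2 else 0)%R.
Proof. by move=> m m_fin m_inv mver s ss; rewrite ver_weight. Qed.

(** Neither axis has measure strictly between 0 and 1, and they cannot both be null
because the interior carries no mass. *)
Lemma ergodic_boundary (R : realType) (mu : probability X R) :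
  invariant_measure mu -> ergodic_measure mu ->
  mu X_hor = 1%E \/ mu X_ver = 1%E.
Proof.
move=> imu emu.
have [h0|] := emu _ measurable_X_hor (ex_intro _ _ X_hor_saturated); last by left.
have [v0|] := emu _ measurable_X_ver (ex_intro _ _ X_ver_saturated); last by right.
have mT : (mu setT < +oo)%E by rewrite probability_setT ltey.
have /(etrans (esym (probability_setT mu))) /eqP := boundary_full mT imu h0 v0.
by rewrite onee_eq0.
Qed.

Lemma same_measure_transfer (R : realType) (mu nu : probability X R) :
  same_measure mu nu -> invariant_measure nu -> ergodic_measure nu ->
  invariant_measure mu /\ ergodic_measure mu.
Proof.
move=> mn inu enu; split=> [s t ss st se|A mA hA]; last by rewrite mn //; exact: enu.
by rewrite !mn; [exact: inu | exact: measurable_cylinder..].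
Qed.

Theorem theorem2p1 (R : realType) :
  exists mu_hor mu_ver : probability X R,
    [/\ unique_invariant_on X_hor mu_hor,
        unique_invariant_on X_ver mu_ver
      & forall mu : probability X R,
          (invariant_measure mu /\ ergodic_measure mu) <->
          (same_measure mu mu_hor \/ same_measure mu mu_ver)].
Proof.
have [mu_hor [ih /(_ X_hor) h1]] := @ray_measure_ex R 2 _ isT hor_ray.
have [mu_ver [iv /(_ X_ver) v1]] := @ray_measure_ex R 3 _ isT ver_ray.
have {}h1 : mu_hor X_hor = 1%E by apply: h1 => x xh n; rewrite xh.
have {}v1 : mu_ver X_ver = 1%E by apply: v1 => x xv n; rewrite xv.
have mh := measurable_X_hor; have mv := measurable_X_ver.
have rh := @rigid_hor R; have rv := @rigid_ver R.
exists mu_hor, mu_ver; split.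
- by split=> // nu inu nu1; exact: (rigid_unique mh rh).
- by split=> // nu inu nu1; exact: (rigid_unique mv rv).
move=> mu; split=> [[imu emu]|[]].
- have [mu1|mu1] := ergodic_boundary imu emu.
  + by left; exact: (rigid_unique mh rh).
  + by right; exact: (rigid_unique mv rv).
- by move=> /same_measure_transfer; apply => //; exact: (rigid_ergodic mh rh).
- by move=> /same_measure_transfer; apply => //; exact: (rigid_ergodic mv rv).
Qed.
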